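(* Let $n\ge 2$ and let $F_{n,n}=F_n*\mathbb{Z}^n$, where $F_n=\langle y_1,\dots,y_n\rangle$ is free of rank $n$ and $\mathbb{Z}^n=\langle v_1,\dots,v_n\rangle$ is free abelian of rank $n$. The representation $\widetilde\varphi_M: VB_n\to\mathrm{Aut}(F_{n,n})$ defined by the action on the generators (generators not listed are fixed) $$\widetilde\varphi_M(\sigma_i):\; y_i\mapsto y_iy_{i+1}y_i^{-1},\quad y_{i+1}\mapsto y_i,\quad v_i\mapsto v_{i+1},\quad v_{i+1}\mapsto v_i,$$ $$\widetilde\varphi_M(\rho_i):\; y_i\mapsto y_{i+1}^{v_i^{-1}},\quad y_{i+1}\mapsto y_i^{v_{i+1}},\quad v_i\mapsto v_{i+1},\quad v_{i+1}\mapsto v_i,$$ $1\le i\le n-1$, is equivalent to the representation $\varphi_M: VB_n\to\mathrm{Aut}(F_{n,2n+1})$; that is, for every $\beta\in VB_n$ one has $\varphi_M(\beta)=1$ if and only if $\widetilde\varphi_M(\beta)=1$.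
   Context: Notation: $a^b=b^{-1}ab$ and $a^{-b}=(a^{-1})^b$. Automorphisms act on the right: a product $\varphi\psi$ means first $\varphi$, then $\psi$. The virtual braid group $VB_n$ is generated by $\sigma_1,\dots,\sigma_{n-1},\rho_1,\dots,\rho_{n-1}$ with defining relations: $\sigma_i\sigma_{i+1}\sigma_i=\sigma_{i+1}\sigma_i\sigma_{i+1}$, $\rho_i\rho_{i+1}\rho_i=\rho_{i+1}\rho_i\rho_{i+1}$, $\rho_i\rho_{i+1}\sigma_i=\sigma_{i+1}\rho_i\rho_{i+1}$ for $1\le i\le n-2$; $\sigma_i\sigma_j=\sigma_j\sigma_i$, $\rho_i\rho_j=\rho_j\rho_i$, $\sigma_i\rho_j=\rho_j\sigma_i$ for $|i-j|\ge 2$; $\rho_i^2=1$. $F_{n,2n+1}=F_n*\mathbb{Z}^{2n+1}$, where $F_n$ is free on $x_1,\dots,x_n$ and $\mathbb{Z}^{2n+1}$ is free abelian on $u_1,\dots,u_n,v_0,v_1,\dots,v_n$. The representation $\varphi_M:VB_n\to\mathrm{Aut}(F_{n,2n+1})$ is given by (unlisted generators fixed) $\varphi_M(\sigma_i): x_i\mapsto x_ix_{i+1}^{u_i}x_i^{-v_0u_{i+1}},\ x_{i+1}\mapsto x_i^{v_0},\ u_i\leftrightarrow u_{i+1},\ v_i\leftrightarrow v_{i+1}$; $\varphi_M(\rho_i): x_i\mapsto x_{i+1}^{v_i^{-1}},\ x_{i+1}\mapsto x_i^{v_{i+1}},\ u_i\leftrightarrow u_{i+1},\ v_i\leftrightarrow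 v_{i+1}$. Two representations of $VB_n$ by automorphisms of (possibly different) groups are called equivalent if they have the same kernel. *)

(* Defs.v *)
From HB Require Import structures.
From mathcomp Require Import all_boot perm.
From mathcomp Require Import boolp.

Set Implicit Arguments.
Unset Strict Implicit.
Unset Printing Implicit Defensive.

Local Open Scope quotient_scope.

(* The letter (x, false) stands for x and (x, true) for x^-1. *)
Definition word (X : Type) := seq (X * bool).

Definition letter_inv (X : Type) (a : X * bool) : X * bool := (a.1, ~~ a.2).

Definition word_inv (X : Type) (w : word X) : word X :=
  rev (map (@letter_inv X) w).

Definition posw (X : Type) (s : seq X) : word X := [seq (x, false) | x <- s].

(* prel w1 w2 is the defining relation w1 = w2. *)
Record presentation := Presentation {
  pgen : choiceType;
  prel : word pgen -> word pgen -> Prop }.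

Inductive word_eq (P : presentation) : word (pgen P) -> word (pgen P) -> Prop :=
| word_eq_rel w1 w2 of prel w1 w2 : word_eq w1 w2
| word_eq_cancel a : word_eq [:: a; letter_inv a] [::]
| word_eq_refl w : word_eq w w
| word_eq_sym w1 w2 of word_eq w1 w2 : word_eq w2 w1
| word_eq_trans w1 w2 w3 of word_eq w1 w2 & word_eq w2 w3 : word_eq w1 w3
| word_eq_cat w1 w2 w3 w4 of word_eq w1 w2 & word_eq w3 w4 :
    word_eq (w1 ++ w3) (w2 ++ w4).

Section PresentedGroup.
Variable P : presentation.
Implicit Types w : word (pgen P).

Definition word_eqb w1 w2 : bool := `[< word_eq w1 w2 >].

Lemma word_eqb_refl : reflexive word_eqb.
Proof. by move=> w; apply/asboolP; apply: word_eq_refl. Qed.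

Lemma word_eqb_sym : symmetric word_eqb.
Proof. by move=> w1 w2; apply/asboolP/asboolP; apply: word_eq_sym. Qed.

Lemma word_eqb_trans : transitive word_eqb.
Proof.
by move=> w2 w1 w3 /asboolP h /asboolP h'; apply/asboolP; apply: word_eq_trans h'.
Qed.

Canonical word_equiv : equiv_rel (seq (pgen P * bool)) :=
  EquivRel word_eqb word_eqb_refl word_eqb_sym word_eqb_trans.

Definition presented : Type := {eq_quot word_equiv}.

HB.instance Definition _ := Choice.on presented.

Definition pclass w : presented := \pi_({eq_quot word_equiv}) w.
Definition prepr (g : presented) : word (pgen P) :=
  repr (g : {eq_quot word_equiv}).

Lemma preprK g : pclass (prepr g) = g.
Proof. exact: (@reprK _ {eq_quot word_equiv} g). Qed.

Lemma pclassP w1 w2 : pclass w1 = pclass w2 <-> word_eq w1 w2.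
Proof.
split=> [e|h].
  by apply/asboolP; have /eqmodP := e.
by apply/eqmodP; apply/asboolP.
Qed.

Lemma prepr_class w : word_eq (prepr (pclass w)) w.
Proof. by apply/pclassP; rewrite preprK. Qed.

Lemma word_inv_cons a w : word_inv (a :: w) = word_inv w ++ [:: letter_inv a].
Proof. by rewrite /word_inv /= rev_cons -cats1. Qed.

Lemma word_mulV w : word_eq (w ++ word_inv w) [::].
Proof.
elim: w => [|a w IHw]; first exact: word_eq_refl.
rewrite word_inv_cons -cat1s -catA (catA w).
apply: word_eq_trans (word_eq_cancel a); rewrite -[X in word_eq _ X]cat1s.
apply: word_eq_cat; first exact: word_eq_refl.
rewrite -[X in word_eq _ X]cat0s.
by apply: word_eq_cat => //; apply: word_eq_refl.
Qed.

Lemma word_invK w : word_inv (word_inv w) = w.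
Proof.
rewrite /word_inv map_rev revK -map_comp map_id_in // => -[x b] _.
by rewrite /= /letter_inv /= negbK.
Qed.

Lemma word_mulVl w : word_eq (word_inv w ++ w) [::].
Proof. by have := word_mulV (word_inv w); rewrite word_invK. Qed.

Definition pmul (g h : presented) : presented := pclass (prepr g ++ prepr h).
Definition pone : presented := pclass [::].
Definition pinv (g : presented) : presented := pclass (word_inv (prepr g)).

Lemma pmul_class w1 w2 : pmul (pclass w1) (pclass w2) = pclass (w1 ++ w2).
Proof. by apply/pclassP/word_eq_cat; apply: prepr_class. Qed.

Lemma pmulA : associative pmul.
Proof.
move=> g h k; rewrite -(preprK g) -(preprK h) -(preprK k).
by rewrite !pmul_class catA.
Qed.

Lemma pmul1 : left_id pone pmul.
Proof. by move=> g; rewrite -(preprK g) pmul_class. Qed.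

Lemma pmulr1 : right_id pone pmul.
Proof. by move=> g; rewrite -(preprK g) pmul_class cats0. Qed.

Lemma pmulV : left_inverse pone pinv pmul.
Proof.
move=> g; rewrite -[X in pmul _ X]preprK pmul_class.
by apply/pclassP/word_mulVl.
Qed.

Lemma pmulrV : right_inverse pone pinv pmul.
Proof.
move=> g; rewrite -[X in pmul X]preprK pmul_class.
by apply/pclassP/word_mulV.
Qed.

HB.instance Definition _ :=
  isGroup.Build presented pmulA pmul1 pmulr1 pmulV pmulrV.

Definition pgenerator (x : pgen P) : presented := pclass (posw [:: x]).

End PresentedGroup.

Definition free_pres (X : choiceType) : presentation :=
  @Presentation X (fun _ _ => False).

Inductive commute_rel (X : Type) : word X -> word X -> Prop :=
| CommuteRel x y : commute_rel (posw [:: x; y]) (posw [:: y; x]).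

Definition free_abelian_pres (X : choiceType) : presentation :=
  @Presentation X (@commute_rel X).

(* <X | R> * <Y | S> = <X + Y | R + S> *)
Inductive free_prod_rel (P Q : presentation) :
  word (pgen P + pgen Q) -> word (pgen P + pgen Q) -> Prop :=
| FreeProdL w1 w2 of @prel P w1 w2 :
    free_prod_rel [seq (inl a.1, a.2) | a <- w1] [seq (inl a.1, a.2) | a <- w2]
| FreeProdR w1 w2 of @prel Q w1 w2 :
    free_prod_rel [seq (inr a.1, a.2) | a <- w1] [seq (inr a.1, a.2) | a <- w2].

Definition free_prod_pres (P Q : presentation) : presentation :=
  @Presentation (pgen P + pgen Q)%type (@free_prod_rel P Q).

(* The n - 1 indices i of the generators sigma_i, rho_i are counted from 0;   *)
(* low i and high i are the indices i and i + 1 in {0, ..., n - 1}.           *)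
Lemma high_subproof (n : nat) (i : 'I_n.-1) : i.+1 < n.
Proof. by case: n i => [|n] [i]. Qed.

Definition low (n : nat) (i : 'I_n.-1) : 'I_n := widen_ord (leq_pred n) i.
Definition high (n : nat) (i : 'I_n.-1) : 'I_n := Ordinal (high_subproof i).

Inductive VB_gen (n : nat) := Sigma of 'I_n.-1 | Rho of 'I_n.-1.

HB.instance Definition _ (n : nat) := gen_eqMixin (VB_gen n).
HB.instance Definition _ (n : nat) := gen_choiceMixin (VB_gen n).

Definition far (i j : nat) : bool := (i.+2 <= j) || (j.+2 <= i).

Inductive VB_rel (n : nat) : word (VB_gen n) -> word (VB_gen n) -> Prop :=
| VB_sss (i j : 'I_n.-1) of j = i.+1 :> nat :
    VB_rel (posw [:: Sigma i; Sigma j; Sigma i])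
           (posw [:: Sigma j; Sigma i; Sigma j])
| VB_rrr (i j : 'I_n.-1) of j = i.+1 :> nat :
    VB_rel (posw [:: Rho i; Rho j; Rho i]) (posw [:: Rho j; Rho i; Rho j])
| VB_rrs (i j : 'I_n.-1) of j = i.+1 :> nat :
    VB_rel (posw [:: Rho i; Rho j; Sigma i]) (posw [:: Sigma j; Rho i; Rho j])
| VB_ss (i j : 'I_n.-1) of far i j :
    VB_rel (posw [:: Sigma i; Sigma j]) (posw [:: Sigma j; Sigma i])
| VB_rr (i j : 'I_n.-1) of far i j :
    VB_rel (posw [:: Rho i; Rho j]) (posw [:: Rho j; Rho i])
| VB_sr (i j : 'I_n.-1) of far i j :
    VB_rel (posw [:: Sigma i; Rho j]) (posw [:: Rho j; Sigma i])
| VB_r2 (i : 'I_n.-1) :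
    VB_rel (posw [:: Rho i; Rho i]) [::].

Definition VB_pres (n : nat) : presentation := @Presentation (VB_gen n) (@VB_rel n).
Notation VB n := (presented (VB_pres n)).

Definition sigma (n : nat) (i : 'I_n.-1) : VB n := @pgenerator (VB_pres n) (Sigma i).
Definition rho (n : nat) (i : 'I_n.-1) : VB n := @pgenerator (VB_pres n) (Rho i).

Section Automorphisms.
Variable G : groupType.

Record aut := Aut {
  aut_fun :> G -> G;
  autM : {morph aut_fun : x y / (x * y)%g};
  aut_bij : bijective aut_fun }.

HB.instance Definition _ := gen_eqMixin aut.
HB.instance Definition _ := gen_choiceMixin aut.

Lemma autP (f g : aut) : f =1 g -> f = g.
Proof.
case: f g => [f fM fB] [g gM gB] /= /funext fg.
case: g / fg gM gB => gM gB.
by rewrite (Prop_irrelevance fM gM) (Prop_irrelevance fB gB).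
Qed.

(* f * g is "first f, then g". *)
Definition aut_mul (f g : aut) : aut.
Proof.
refine (@Aut (fun x => g (f x)) _ (bij_comp (aut_bij g) (aut_bij f))).
by move=> x y; rewrite !autM.
Defined.

Definition aut_one : aut.
Proof. by refine (@Aut id _ _) => //; exists id. Defined.

Lemma aut_inv_subproof (f : aut) : exists g : aut, cancel f g /\ cancel g f.
Proof.
have [h fK hK] := aut_bij f.
have hM : {morph h : x y / (x * y)%g}.
  by move=> x y; apply: (can_inj fK); rewrite autM !hK.
by exists (Aut hM (Bijective hK fK)).
Qed.

Definition aut_inv (f : aut) : aut := sval (cid (aut_inv_subproof f)).

Lemma aut_mulA : associative aut_mul.
Proof. by move=> f g h; apply: autP. Qed.
Lemma aut_mul1 : left_id aut_one aut_mul.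
Proof. by move=> f; apply: autP. Qed.
Lemma aut_mulr1 : right_id aut_one aut_mul.
Proof. by move=> f; apply: autP. Qed.
Lemma aut_mulV : left_inverse aut_one aut_inv aut_mul.
Proof.
by move=> f; apply: autP => x /=; case: (svalP (cid (aut_inv_subproof f))).
Qed.
Lemma aut_mulrV : right_inverse aut_one aut_inv aut_mul.
Proof.
by move=> f; apply: autP => x /=; case: (svalP (cid (aut_inv_subproof f))).
Qed.

HB.instance Definition _ :=
  isGroup.Build aut aut_mulA aut_mul1 aut_mulr1 aut_mulV aut_mulrV.

End Automorphisms.

(* Equivalence of representations is equality of kernels. *)
Definition equivalent_rep (K G H : groupType)
    (phi : {multiplicative K -> aut G}) (psi : {multiplicative K -> aut H}) :=
  forall b : K, phi b = 1%g <-> psi b = 1%g.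

(* F_n * Z^(2n+1); the basis of Z^(2n+1) is u_1, ..., u_n (left summand) and  *)
(* v_0, v_1, ..., v_n (right summand, v_0 at ord0 and v_j at lift ord0 j).    *)
Definition FM_pres (n : nat) : presentation :=
  free_prod_pres (free_pres 'I_n) (free_abelian_pres ('I_n + 'I_n.+1)%type).
Notation FM n := (presented (FM_pres n)).

Section PhiM.
Variable n : nat.

Definition FM_x (j : 'I_n) : FM n := @pgenerator (FM_pres n) (inl j).
Definition FM_u (j : 'I_n) : FM n := @pgenerator (FM_pres n) (inr (inl j)).
Definition FM_v0 : FM n := @pgenerator (FM_pres n) (inr (inr ord0)).
Definition FM_v (j : 'I_n) : FM n := @pgenerator (FM_pres n) (inr (inr (lift ord0 j))).

Local Open Scope group_scope.
Local Notation x := FM_x.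
Local Notation u := FM_u.
Local Notation v := FM_v.
Local Notation v0 := FM_v0.

Definition phiM_sigma_spec (i : 'I_n.-1) (f : aut (FM n)) : Prop :=
  [/\ [/\ f (x (low i)) = x (low i) * x (high i) ^ u (low i)
                           * (x (low i))^-1 ^ (v0 * u (high i)),
          f (x (high i)) = x (low i) ^ v0
        & forall j, j != low i -> j != high i -> f (x j) = x j],
      forall j, f (u j) = u (tperm (low i) (high i) j),
      f v0 = v0
    & forall j, f (v j) = v (tperm (low i) (high i) j)].

Definition phiM_rho_spec (i : 'I_n.-1) (f : aut (FM n)) : Prop :=
  [/\ [/\ f (x (low i)) = x (high i) ^ (v (low i))^-1,
          f (x (high i)) = x (low i) ^ v (high i)
        & forall j, j != low i -> j != high i -> f (x j) = x j],
      forall j, f (u j) = u (tperm (low i) (high i) j),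
      f v0 = v0
    & forall j, f (v j) = v (tperm (low i) (high i) j)].

Definition is_phiM (phi : {multiplicative VB n -> aut (FM n)}) : Prop :=
  forall i : 'I_n.-1,
    phiM_sigma_spec i (phi (sigma i)) /\ phiM_rho_spec i (phi (rho i)).

End PhiM.

(* F_n * Z^n *)
Definition FT_pres (n : nat) : presentation :=
  free_prod_pres (free_pres 'I_n) (free_abelian_pres 'I_n).
Notation FT n := (presented (FT_pres n)).

Section TildePhiM.
Variable n : nat.

Definition FT_y (j : 'I_n) : FT n := @pgenerator (FT_pres n) (inl j).
Definition FT_v (j : 'I_n) : FT n := @pgenerator (FT_pres n) (inr j).

Local Open Scope group_scope.
Local Notation y := FT_y.
Local Notation v := FT_v.

Definition tphiM_sigma_spec (i : 'I_n.-1) (f : aut (FT n)) : Prop :=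
  [/\ [/\ f (y (low i)) = y (low i) * y (high i) * (y (low i))^-1,
          f (y (high i)) = y (low i)
        & forall j, j != low i -> j != high i -> f (y j) = y j]
    & forall j, f (v j) = v (tperm (low i) (high i) j)].

Definition tphiM_rho_spec (i : 'I_n.-1) (f : aut (FT n)) : Prop :=
  [/\ [/\ f (y (low i)) = y (high i) ^ (v (low i))^-1,
          f (y (high i)) = y (low i) ^ v (high i)
        & forall j, j != low i -> j != high i -> f (y j) = y j]
    & forall j, f (v j) = v (tperm (low i) (high i) j)].

Definition is_tphiM (phi : {multiplicative VB n -> aut (FT n)}) : Prop :=
  forall i : 'I_n.-1,
    tphiM_sigma_spec i (phi (sigma i)) /\ tphiM_rho_spec i (phi (rho i)).

End TildePhiM.

(* Main.v *)
(* Put w_j = x_j u_j^-1 v_0^-1, let z_j be w_j conjugated by v_0^-j, and let  *)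
(* v'_j = v_j v_0^-1. Then the z_j, u_j, v_0, v'_j form another basis of      *)
(* F_n * Z^(2n+1); phi_M(b) acts on the z_j, v'_j as tilde phi_M(b) acts on   *)
(* the y_j, v_j, fixes v_0, and permutes the u_j as tilde phi_M(b) permutes   *)
(* the v_j. So phi_M(b) and tilde phi_M(b) determine each other, and the      *)
(* relations of VB_n need checking for tilde phi_M only.                      *)
From HB Require Import structures.
From mathcomp Require Import boolp.
Require Import Defs.
From mathcomp Require Import all_boot perm zify.

Set Implicit Arguments.
Unset Strict Implicit.
Unset Printing Implicit Defensive.

Local Open Scope group_scope.

(** In the coordinates w_j = x_j u_j^-1 v_0^-1 the automorphism phi_M(sigma_i) reads w_i -> w_i
    w_(i+1)^(v_0^-1) w_i^-1, w_(i+1) -> w_i^(v_0), with no u left in it. Conjugating w_j by v_0^-j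
    absorbs these powers of v_0. The same conjugation puts one factor v_0 into the formulas for
    rho_i, and replacing v_j by v_j v_0^-1 absorbs it. So [emb], sending y_j to z_j and v_j to v_j
    v_0^-1, carries the action of tilde phi_M to that of phi_M; it is injective because [retr] is a
    left inverse.

    An automorphism F of F_(n,2n+1) [lifts] f when it agrees with f through [emb], fixes v_0 and
    permutes the u_j as f permutes the v_j. The image of [emb], v_0 and the u_j generate, so f
    determines F ([lifts_unique]); injectivity of [emb] gives the converse, whence [lifts_eq1].
    Lifting respects products and inverses, and lifts of the tilde generators satisfy the formulas
    of phi_M ([lifts_sigma], [lifts_rho]). Hence phi_M(b) lifts tilde phi_M(b) for every b
    ([lifts_of_specs]), and the kernels agree.

    For existence, the relations of VB_n are verified in F_(n,n) ([VB_aut_respects]); upstairs, both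
    sides of a relation lift the same automorphism and so coincide. *)

Local Notation hom := UMagmaMorphism.type.

(** * Homomorphisms out of a presented group *)

Section UniversalProperty.
Variables (P : presentation) (H : groupType).

Definition letter_eval (f : pgen P -> H) (a : pgen P * bool) : H :=
  if a.2 then (f a.1)^-1 else f a.1.

Definition word_eval (f : pgen P -> H) (w : word (pgen P)) : H :=
  \prod_(a <- w) letter_eval f a.

Definition respects (f : pgen P -> H) : Prop :=
  forall w1 w2, prel w1 w2 -> word_eval f w1 = word_eval f w2.

Lemma word_eval_eq f w1 w2 :
  respects f -> word_eq w1 w2 -> word_eval f w1 = word_eval f w2.
Proof.
move=> fR; elim=> {w1 w2} [w1 w2 /fR //|[x b]|//|//|w1 w2 w3 _ -> _ -> //|].
  rewrite /word_eval big_cons big_seq1 big_nil /letter_eval /=.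
  by case: b; rewrite /= (mulVg, mulgV).
by move=> w1 w2 w3 w4 _ e12 _ e34; rewrite /word_eval !big_cat; congr (_ * _).
Qed.

Definition plift f of respects f := fun g : presented P => word_eval f (prepr g).

Section Plift.
Variables (f : pgen P -> H) (fR : respects f).

Lemma plift_class w : plift fR (pclass w) = word_eval f w.
Proof. exact/word_eval_eq/prepr_class. Qed.

Lemma plift_morphism : monoid_morphism (plift fR).
Proof.
split=> [|g h]; first by rewrite [LHS]plift_class /word_eval big_nil.
by rewrite [LHS]plift_class /word_eval big_cat.
Qed.

HB.instance Definition _ :=
  isUMagmaMorphism.Build (presented P) H (plift fR) plift_morphism.

Lemma plift_generator x : plift fR (pgenerator x) = f x.
Proof. by rewrite plift_class /word_eval big_seq1. Qed.

End Plift.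

Lemma presented_ind (Q : presented P -> Prop) :
    Q 1 -> (forall x g, Q g -> Q (pgenerator x * g)) ->
    (forall x g, Q g -> Q ((pgenerator x)^-1 * g)) ->
  forall g, Q g.
Proof.
move=> Q1 Qx QV g; rewrite -(preprK g); elim: (prepr g) => [//|[x []] w IHw].
  suff -> : pclass ((x, true) :: w) = (@pgenerator P x)^-1 * pclass w.
    exact: QV.
  apply: (mulgI (@pgenerator P x)); rewrite mulVKg [LHS]pmul_class.
  apply/pclassP; rewrite -[X in word_eq _ X]cat0s.
  apply: (@word_eq_cat P [:: (x, false); (x, true)] [::] w w).
    exact: word_eq_cancel.
  exact: word_eq_refl.
suff -> : pclass ((x, false) :: w) = @pgenerator P x * pclass w by exact: Qx.
by rewrite [RHS]pmul_class.
Qed.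

Lemma hom_eq (F G : hom (presented P) H) :
  (forall x, F (pgenerator x) = G (pgenerator x)) -> F =1 G.
Proof.
move=> FG; apply: presented_ind => [|x g IH|x g IH]; first by rewrite !gmulf1.
  by rewrite !gmulfM IH FG.
by rewrite !gmulfM !gmulfV IH FG.
Qed.

End UniversalProperty.

(** * Free products of a free and a free abelian group *)

Section FreeTimesAbelian.
Variables (I A : choiceType) (H : groupType) (f : I -> H) (h : A -> H).
Local Notation FA := (free_prod_pres (free_pres I) (free_abelian_pres A)).

Lemma free_abelian_respects :
  (forall a b, commute (h a) (h b)) ->
  @respects FA H (fun x => match x with inl i => f i | inr a => h a end).
Proof.
move=> hC w1 w2 /= [//|{}w1 {}w2 /= [a b]].
by rewrite /word_eval /= !big_cons !big_nil /letter_eval /= !mulg1 hC.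
Qed.

End FreeTimesAbelian.

Lemma FA_commute (I A : choiceType) a b :
  commute (@pgenerator (free_prod_pres (free_pres I) (free_abelian_pres A)) (inr a))
          (@pgenerator (free_prod_pres (free_pres I) (free_abelian_pres A)) (inr b)).
Proof.
rewrite /commute [LHS]pmul_class [RHS]pmul_class; apply/pclassP/word_eq_rel.
exact: (@FreeProdR (free_pres I) (free_abelian_pres A) _ _ (CommuteRel a b)).
Qed.

(** * Automorphisms as homomorphisms, and conjugation *)

Section Mult.
Variables (K L : groupType) (phi : {multiplicative K -> L}).

Lemma multiplicative1 : phi 1 = 1.
Proof. by apply: (mulgI (phi 1)); rewrite -gmulfM !mulg1. Qed.

Lemma multiplicativeV x : phi x^-1 = (phi x)^-1.
Proof. by apply: (mulgI (phi x)); rewrite -gmulfM !mulgV multiplicative1. Qed.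

End Mult.

HB.instance Definition _ (G : groupType) (f : aut G) :=
  isMultiplicative.Build G G f (@autM G f).
HB.instance Definition _ (G : groupType) (f : aut G) :=
  Multiplicative_isUMagmaMorphism.Build G G f (multiplicative1 f).

Definition aut_of (G : groupType) (F F' : hom G G)
  (FK : cancel F F') (FK' : cancel F' F) : aut G :=
  Aut (@gmulfM _ _ F) (Bijective FK FK').

Lemma conjgAC (G : groupType) (x a b : G) :
  commute a b -> (x ^ a) ^ b = (x ^ b) ^ a.
Proof. by move=> ab; rewrite -!conjgM ab. Qed.

Lemma conjg_conj (G : groupType) (x y z : G) :
  (x * y / x) ^ z = x ^ z * y ^ z / x ^ z.
Proof. by rewrite !conjMg conjVg. Qed.

Lemma commuteVl (G : groupType) (a b : G) : commute a b -> commute a^-1 b.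
Proof. by move=> ab; apply/commute_sym/commuteV/commute_sym. Qed.

(** * The automorphisms of F_(n,n) and the relations of VB_n *)

Section FT.
Variable n : nat.
Local Notation y := (@FT_y n).
Local Notation v := (@FT_v n).

Lemma FT_vC j k : commute (v j) (v k).
Proof. exact: FA_commute. Qed.

Section Lift.
Variables (H : groupType) (f : 'I_n -> H) (h : 'I_n -> H).
Hypothesis hC : forall j k, commute (h j) (h k).

Definition FT_lift : hom (presented (FT_pres n)) H :=
  plift (free_abelian_respects f hC).

Lemma FT_lift_y j : FT_lift (y j) = f j.
Proof. exact: (plift_generator (free_abelian_respects f hC)). Qed.

Lemma FT_lift_v j : FT_lift (v j) = h j.
Proof. exact: (plift_generator (free_abelian_respects f hC)). Qed.

End Lift.

Lemma FT_hom_eq (H : groupType) (F G : hom (presented (FT_pres n)) H) :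
  (forall j, F (y j) = G (y j)) -> (forall j, F (v j) = G (v j)) -> F =1 G.
Proof. by move=> Fy Fv; apply: hom_eq => -[j|j]; [apply: Fy|apply: Fv]. Qed.

(** A homomorphism to the permutations of [bool] sending [v j] to the transposition and every other
    generator to 1 separates [v j] from [v k]. Consequently an automorphism that permutes the [v j]
    determines the permutation. *)
Lemma FT_v_inj : injective v.
Proof.
move=> j k vjk; apply: contraTeq isT => /negPf jk.
pose h l : {perm bool} := if l == j then tperm true false else 1.
have hC l m : commute (h l) (h m).
  by rewrite /commute /h; do 2!case: ifP => _; rewrite ?mulg1 ?mul1g.
have := congr1 (FT_lift (fun=> 1) hC) vjk.
rewrite !FT_lift_v /h eqxx eq_sym jk => /permP /(_ true).
by rewrite tpermL perm1.
Qed.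

Section Generators.
Variables a b : 'I_n.

Let vtC j k : commute (v (tperm a b j)) (v (tperm a b k)).
Proof. exact: FT_vC. Qed.

Definition sigma_hom := FT_lift (fun k => if k == a then y a * y b * (y a)^-1
  else if k == b then y a else y k) vtC.

Definition sigma_inv_hom := FT_lift (fun k => if k == a then y b
  else if k == b then y a ^ y b else y k) vtC.

Definition rho_hom := FT_lift (fun k => if k == a then y b ^ (v a)^-1
  else if k == b then y a ^ v b else y k) vtC.

Lemma sigma_hom_y k : sigma_hom (y k) =
  if k == a then y a * y b * (y a)^-1 else if k == b then y a else y k.
Proof. exact: FT_lift_y. Qed.

Lemma sigma_inv_hom_y k : sigma_inv_hom (y k) =
  if k == a then y b else if k == b then y a ^ y b else y k.
Proof. exact: FT_lift_y. Qed.

Lemma rho_hom_y k : rho_hom (y k) =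
  if k == a then y b ^ (v a)^-1 else if k == b then y a ^ v b else y k.
Proof. exact: FT_lift_y. Qed.

Let vt k : v (tperm a b k) = v (if k == a then b else if k == b then a else k).
Proof. by rewrite permE. Qed.

Lemma sigma_hom_v k :
  sigma_hom (v k) = v (if k == a then b else if k == b then a else k).
Proof. by rewrite [LHS]FT_lift_v vt. Qed.

Lemma sigma_inv_hom_v k :
  sigma_inv_hom (v k) = v (if k == a then b else if k == b then a else k).
Proof. by rewrite [LHS]FT_lift_v vt. Qed.

Lemma rho_hom_v k :
  rho_hom (v k) = v (if k == a then b else if k == b then a else k).
Proof. by rewrite [LHS]FT_lift_v vt. Qed.

End Generators.

Definition gen_homE := (sigma_hom_y, sigma_inv_hom_y, rho_hom_y,
  sigma_hom_v, sigma_inv_hom_v, rho_hom_v).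

Ltac simp_gens E :=
  repeat progress rewrite [LHS]/= [RHS]/= ?(gmulfJ, gmulfM, gmulfV) /= ?gen_homE ?E.

(** Continuation style lets each negative comparison of [k] join the rewrite tuple [E] before the
    next index is tried. *)
Ltac case_index k a E cont :=
  let ka := fresh "ka" in
  case ka : (k == a); [rewrite ?(eqP ka); simp_gens E|cont (ka, E)].

Lemma sigmaK a b : a != b -> cancel (sigma_hom a b) (sigma_inv_hom a b).
Proof.
move=> /negPf ab; have E := (ab, eq_sym b a, eqxx).
apply: (@FT_hom_eq _ (sigma_inv_hom a b \o sigma_hom a b) idfun) => k;
  case_index k a E ltac:(fun E => case_index k b E simp_gens) => //.
by rewrite /conjg !mulgA mulgV mul1g mulgK.
Qed.

Lemma sigmaKV a b : a != b -> cancel (sigma_inv_hom a b) (sigma_hom a b).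
Proof.
move=> /negPf ab; have E := (ab, eq_sym b a, eqxx).
apply: (@FT_hom_eq _ (sigma_hom a b \o sigma_inv_hom a b) idfun) => k;
  case_index k a E ltac:(fun E => case_index k b E simp_gens) => //.
by rewrite /conjg !mulgA mulVg mul1g mulgVK.
Qed.

Lemma rhoK a b : a != b -> involutive (rho_hom a b).
Proof.
move=> /negPf ab; have E := (ab, eq_sym b a, eqxx).
apply: (@FT_hom_eq _ (rho_hom a b \o rho_hom a b) idfun) => k;
  case_index k a E ltac:(fun E => case_index k b E simp_gens) => //.
  by rewrite conjgK.
by rewrite conjgKV.
Qed.

Section Braid.
Variables a b c : 'I_n.
Hypotheses (ab : a != b) (bc : b != c) (ac : a != c).

Let E := (negPf ab, negPf bc, negPf ac, eq_sym b a, eq_sym c b, eq_sym c a, eqxx).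

Ltac case_abc k :=
  case_index k a E ltac:(fun E => case_index k b E
    ltac:(fun E => case_index k c E simp_gens)).

Lemma sigma_braid : sigma_hom a b \o sigma_hom b c \o sigma_hom a b
  =1 sigma_hom b c \o sigma_hom a b \o sigma_hom b c.
Proof.
apply: FT_hom_eq => k; case_abc k => //.
by rewrite !invgM !invgK !mulgA !mulgVK.
Qed.

(** On each of the three moved y's, both sides conjugate one generator by the same two commuting
    elements, in opposite orders. *)
Lemma rho_braid : rho_hom a b \o rho_hom b c \o rho_hom a b
  =1 rho_hom b c \o rho_hom a b \o rho_hom b c.
Proof.
apply: FT_hom_eq => k; case_abc k => //.
all: apply: conjgAC.
- by apply/commuteVl/commuteV/FT_vC.
- by apply/commuteVl/FT_vC.
- exact: FT_vC.
Qed.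

(** Compositions are read from right to left, so this is the relation rho_i rho_(i+1) sigma_i =
    sigma_(i+1) rho_i rho_(i+1) for automorphisms acting on the right. *)
Lemma rho_sigma_braid : sigma_hom a b \o rho_hom b c \o rho_hom a b
  =1 rho_hom b c \o rho_hom a b \o sigma_hom b c.
Proof.
apply: FT_hom_eq => k; case_abc k => //.
- by apply: conjgAC; apply/commuteVl/commuteV/FT_vC.
- exact: conjg_conj.
Qed.

End Braid.

Section Commute.
Variables a b c d : 'I_n.
Hypotheses (ab : a != b) (cd : c != d).
Hypotheses (ac : a != c) (ad : a != d) (bc : b != c) (bd : b != d).

Let E := (negPf ab, negPf cd, negPf ac, negPf ad, negPf bc, negPf bd,
  eq_sym b a, eq_sym d c, eq_sym c a, eq_sym d a, eq_sym c b, eq_sym d b, eqxx).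

Ltac case_abcd k :=
  case_index k a E ltac:(fun E => case_index k b E
    ltac:(fun E => case_index k c E ltac:(fun E => case_index k d E simp_gens))).

Lemma sigma_commute :
  sigma_hom c d \o sigma_hom a b =1 sigma_hom a b \o sigma_hom c d.
Proof. by apply: FT_hom_eq => k; case_abcd k. Qed.

Lemma rho_commute :
  rho_hom c d \o rho_hom a b =1 rho_hom a b \o rho_hom c d.
Proof. by apply: FT_hom_eq => k; case_abcd k. Qed.

Lemma sigma_rho_commute :
  rho_hom c d \o sigma_hom a b =1 sigma_hom a b \o rho_hom c d.
Proof. by apply: FT_hom_eq => k; case_abcd k. Qed.

End Commute.
End FT.

(** * Homomorphisms out of F_(n,2n+1) *)

Section FM.
Variable n : nat.
Local Notation FT := (presented (FT_pres n)).
Local Notation FM := (presented (FM_pres n)).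
Local Notation y := (@FT_y n).
Local Notation x := (@FM_x n).
Local Notation u := (@FM_u n).
Local Notation v := (@FM_v n).
Local Notation v0 := (@FM_v0 n).

Definition FM_abelian (T : Type) (hu : 'I_n -> T) (h0 : T) (hv : 'I_n -> T)
    (c : 'I_n + 'I_n.+1) : T :=
  match c with
  | inl j => hu j
  | inr k => if unlift ord0 k is Some j then hv j else h0
  end.

Section Lift.
Variables (H : groupType) (f hu : 'I_n -> H) (h0 : H) (hv : 'I_n -> H).
Hypothesis hC : forall a b, commute (FM_abelian hu h0 hv a) (FM_abelian hu h0 hv b).

Definition FM_lift : hom FM H := plift (free_abelian_respects f hC).

Lemma FM_lift_x j : FM_lift (x j) = f j.
Proof. exact: (plift_generator (free_abelian_respects f hC)). Qed.

Lemma FM_lift_u j : FM_lift (u j) = hu j.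
Proof. exact: (plift_generator (free_abelian_respects f hC)). Qed.

Lemma FM_lift_v0 : FM_lift v0 = h0.
Proof.
rewrite [LHS](plift_generator (free_abelian_respects f hC)) /=.
by rewrite unlift_none.
Qed.

Lemma FM_lift_v j : FM_lift (v j) = hv j.
Proof.
rewrite [LHS](plift_generator (free_abelian_respects f hC)) /=.
by rewrite liftK.
Qed.

End Lift.

Lemma FM_generator_ind (Q : pgen (FM_pres n) -> Prop) :
    (forall j, Q (inl j)) -> (forall j, Q (inr (inl j))) ->
    Q (inr (inr ord0)) -> (forall j, Q (inr (inr (lift ord0 j)))) ->
  forall c, Q c.
Proof. by move=> Qx Qu Q0 Qv [j|[j|k]] //; case: (unliftP ord0 k) => [j|] ->. Qed.

Lemma FM_eq (H : groupType) (F G : hom FM H) :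
    (forall j, F (x j) = G (x j)) -> (forall j, F (u j) = G (u j)) ->
    F v0 = G v0 -> (forall j, F (v j) = G (v j)) -> F =1 G.
Proof. by move=> Fx Fu F0 Fv; apply: hom_eq; apply: FM_generator_ind. Qed.

Lemma FM_uC j k : commute (u j) (u k). Proof. exact: FA_commute. Qed.
Lemma FM_uv0C j : commute (u j) v0. Proof. exact: FA_commute. Qed.
Lemma FM_vv0C j : commute (v j) v0. Proof. exact: FA_commute. Qed.
Lemma FM_vuC j k : commute (v j) (u k). Proof. exact: FA_commute. Qed.
Lemma FM_vC j k : commute (v j) (v k). Proof. exact: FA_commute. Qed.

(** * The new basis and the embedding of F_(n,n) *)

Definition FM_w j : FM := x j * (u j)^-1 * v0^-1.
Definition FM_z (j : 'I_n) : FM := FM_w j ^ v0 ^- j.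
Local Notation w := FM_w.
Local Notation z := FM_z.

Lemma w_x j : w j * v0 * u j = x j.
Proof. by rewrite !mulgVK. Qed.

Lemma z_w (j : 'I_n) : z j ^ (v0 ^+ j) = w j.
Proof. exact: conjgKV. Qed.

Lemma FM_v'C j k : commute (v j * v0^-1) (v k * v0^-1).
Proof.
have C l m : commute (v l * v0^-1) (v m).
  by apply/commute_sym/commuteM; [exact: FM_vC|apply/commuteV/FM_vv0C].
apply: commuteM => //; apply/commuteV/commute_sym/commuteM.
  exact/commute_sym/FM_vv0C.
exact/commuteV.
Qed.

Definition emb : hom FT FM := FT_lift z FM_v'C.

Lemma emb_y j : emb (y j) = z j. Proof. exact: FT_lift_y. Qed.
Lemma emb_v j : emb (FT_v j) = v j * v0^-1. Proof. exact: FT_lift_v. Qed.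

Lemma retr_commute a b :
  commute (FM_abelian (fun=> 1) 1 (@FT_v n) a) (FM_abelian (fun=> 1) 1 (@FT_v n) b).
Proof.
have e c : FM_abelian (fun=> 1) 1 (@FT_v n) c = 1 \/
    exists j, FM_abelian (fun=> 1) 1 (@FT_v n) c = FT_v j.
  case: c => [j|k]; first by left.
  by rewrite /=; case: unliftP => [j _|_]; [right; exists j|left].
case: (e a) (e b) => [->|[j ->]] [->|[k ->]].
- exact: commute_refl.
- exact/commute_sym/commute1.
- exact: commute1.
- exact: FT_vC.
Qed.

(** Killing [v0] and the [u j] turns [z j] into [y j] and [v j * v0^-1] into [v j]. *)
Definition retr : hom FM FT := FM_lift y retr_commute.

Lemma embK : cancel emb retr.
Proof.
apply: (@FT_hom_eq _ _ (retr \o emb) idfun) => j /=.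
  rewrite emb_y gmulfJ !gmulfM !gmulfV gmulfXn.
  by rewrite FM_lift_x FM_lift_u FM_lift_v0 !invg1 !mulg1 expg1n invg1 conjg1.
by rewrite emb_v gmulfM gmulfV FM_lift_v0 FM_lift_v invg1 mulg1.
Qed.

(** * Lifting automorphisms from F_(n,n) to F_(n,2n+1) *)

Definition intertwine (F : hom FM FM) (f : hom FT FT) (s : {perm 'I_n}) : Prop :=
  [/\ forall g, F (emb g) = emb (f g), F v0 = v0, forall j, F (u j) = u (s j)
    & forall j, f (FT_v j) = FT_v (s j)].

(** The image of [emb], [v0] and the [u j] generate: x_j = z_j^(v_0^j) v_0 u_j, and [v j] is
    [emb (FT_v j) * v0]. *)
Lemma FM_emb_eq (H : groupType) (F G : hom FM H) :
    (forall g, F (emb g) = G (emb g)) -> F v0 = G v0 ->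
    (forall j, F (u j) = G (u j)) -> F =1 G.
Proof.
move=> Fe F0 Fu; apply: FM_eq => // j.
  rewrite -w_x -z_w -emb_y !(gmulfJ, gmulfXn, gmulfM) /=.
  by rewrite Fe F0 Fu.
have -> : v j = emb (FT_v j) * v0 by rewrite emb_v mulgVK.
by rewrite !gmulfM Fe F0.
Qed.

Lemma intertwine_x F f s (j : 'I_n) : intertwine F f s ->
  F (x j) = emb (f (y j)) ^ (v0 ^+ j) * v0 * u (s j).
Proof.
case=> Fe F0 Fu _.
by rewrite -w_x -z_w -emb_y !(gmulfJ, gmulfXn, gmulfM) /= Fe F0 Fu.
Qed.

Lemma intertwine_v F f s j : intertwine F f s -> F (v j) = v (s j).
Proof.
case=> Fe F0 _ fv; have -> : v j = emb (FT_v j) * v0 by rewrite emb_v mulgVK.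
by rewrite gmulfM Fe F0 fv emb_v mulgVK.
Qed.

Section Extension.
Variables (f : hom FT FT) (s : {perm 'I_n}).

Lemma ext_commute a b : commute
  (FM_abelian (fun j => u (s j)) v0 (fun j => v (s j)) a)
  (FM_abelian (fun j => u (s j)) v0 (fun j => v (s j)) b).
Proof.
have e c : exists d, FM_abelian (fun j => u (s j)) v0 (fun j => v (s j)) c =
    @pgenerator (FM_pres n) (inr d).
  case: c => [j|k]; first by exists (inl (s j)).
  rewrite /=; case: unliftP => [j _|_]; last by exists (inr ord0).
  by exists (inr (lift ord0 (s j))).
by have [[c ->] [d ->]] := (e a, e b); apply: FA_commute.
Qed.

(** The value on [x j] is the one that [intertwine_x] forces. *)
Definition ext : hom FM FM :=
  FM_lift (fun j => emb (f (y j)) ^ (v0 ^+ j) * v0 * u (s j)) ext_commute.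

Lemma ext_intertwine :
  (forall j, f (FT_v j) = FT_v (s j)) -> intertwine ext f s.
Proof.
move=> fv; split=> // [|/=|j]; rewrite ?FM_lift_v0 ?FM_lift_u //.
apply: (@FT_hom_eq _ _ (ext \o emb) (emb \o f)) => j /=.
  rewrite emb_y gmulfJ !gmulfM !gmulfV gmulfXn.
  by rewrite FM_lift_x FM_lift_u FM_lift_v0 !mulgK conjgK.
by rewrite fv !emb_v gmulfM gmulfV FM_lift_v0 FM_lift_v.
Qed.

End Extension.

Lemma intertwine_cancel F G f g s :
    intertwine F f s -> intertwine G g s^-1 -> cancel f g -> cancel F G.
Proof.
move=> [Fe F0 Fu _] [Ge G0 Gu _] fK.
apply: (@FM_emb_eq _ (G \o F) idfun) => [h||j] /=.
- by rewrite Fe Ge fK.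
- by rewrite F0 G0.
- by rewrite Fu Gu permK.
Qed.

Lemma aut_cancel (G : groupType) (f : aut G) : cancel f f^-1 /\ cancel f^-1 f.
Proof.
by split=> g; [have := congr1 (fun h : aut G => h g) (mulgV f)
  |have := congr1 (fun h : aut G => h g) (mulVg f)].
Qed.

(** Hiding [s] loses nothing: by [FT_v_inj] it can be read off from the action of [f] on the
    [FT_v j]. *)
Definition lifts (F : aut FM) (f : aut FT) : Prop := exists s, intertwine F f s.

Lemma lifts_exists (f : aut FT) (s : {perm 'I_n}) :
  (forall j, f (FT_v j) = FT_v (s j)) -> exists F, lifts F f.
Proof.
move=> fv; have [fK fVK] := aut_cancel f.
have fVv j : (f^-1 : aut FT) (FT_v j) = FT_v (s^-1 j).
  by apply: (can_inj fK); rewrite fVK fv permKV.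
have I := ext_intertwine fv; have IV := ext_intertwine fVv.
have FK := intertwine_cancel I IV fK.
have FVK : cancel (ext (f^-1 : aut FT) s^-1) (ext f s).
  by apply: (intertwine_cancel IV _ fVK); rewrite invgK.
by exists (aut_of FK FVK), s.
Qed.

Lemma lifts1 : lifts 1 1.
Proof. by exists 1; split=> // j; rewrite perm1. Qed.

Lemma liftsM F G f g : lifts F f -> lifts G g -> lifts (F * G) (f * g).
Proof.
move=> [s [Fe F0 Fu fv]] [t [Ge G0 Gu gv]]; exists (s * t).
split=> [h||j|j] /=; first by rewrite Fe Ge.
- by rewrite F0 G0.
- by rewrite Fu Gu permM.
- by rewrite fv gv permM.
Qed.

Lemma liftsV F f : lifts F f -> lifts F^-1 f^-1.
Proof.
move=> [s [Fe F0 Fu fv]]; exists s^-1.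
have [FK FVK] := aut_cancel F; have [fK fVK] := aut_cancel f.
split=> [h||j|j]; first by apply: (can_inj FK); rewrite FVK Fe /= fVK.
- by apply: (can_inj FK); rewrite FVK F0.
- by apply: (can_inj FK); rewrite FVK Fu permKV.
- by apply: (can_inj fK); rewrite fVK fv permKV.
Qed.

Lemma lifts_unique F G f : lifts F f -> lifts G f -> F = G.
Proof.
move=> [s [Fe F0 Fu fv]] [t [Ge G0 Gu gv]]; apply: autP.
apply: FM_emb_eq => [h||j]; rewrite ?Fe ?F0 ?Fu ?Ge ?G0 ?Gu //.
by congr u; apply: (@FT_v_inj n); rewrite -fv -gv.
Qed.

Lemma lifts_eq1 F f : lifts F f -> (f = 1 <-> F = 1).
Proof.
move=> Ff; split=> [f1|F1].
  by rewrite f1 in Ff; apply: lifts_unique Ff lifts1.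
case: Ff => s [Fe _ _ _]; apply: autP => g.
by apply: (can_inj embK); rewrite -Fe F1.
Qed.

End FM.

(** * Group identities behind the change of basis *)

Section Identities.
Variable G : groupType.
Implicit Types a b p q t : G.

(* Here a, b, p, q, t stand for x_i, x_(i+1), u_i, u_(i+1), v_0. *)
Lemma sigma_low_identity a b p q t : commute p t -> commute p q ->
  (a / p / t) * (b / q / t) ^ t^-1 / (a / p / t) * t * q
    = a * b ^ p * (a^-1) ^ (t * q).
Proof.
move=> pt pq; have E : (t * q)^-1 * p = p * (t * q)^-1.
  exact/esym/commuteV/commuteM.
(* This much is free cancellation; the commutation hypotheses serve only to swap [p] with
   [(t * q)^-1]. *)
transitivity (a / p * b * ((t * q)^-1 * p) * a^-1 * (t * q)).
  by rewrite /conjg !gnorm.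
by rewrite E /conjg !gnorm.
Qed.

Lemma sigma_high_identity a p t :
  commute p t -> (a / p / t) ^ t * t * p = a ^ t.
Proof.
move=> pt.
by rewrite /conjg !gnorm -(mulgA _ p^-1 t) (commuteVl pt) !gnorm.
Qed.

(** As [v] commutes with [t * q], the trailing factor moves inside the conjugation and restores
    [b]. *)
Lemma conj_shift b q t v : commute v t -> commute v q ->
  (b / q / t) ^ v * t * q = b ^ v.
Proof.
move=> vt vq; have E : v * (t * q) = t * q * v by apply: commuteM.
by rewrite -mulgA /conjg -!mulgA E !gnorm.
Qed.

End Identities.

(** * Comparison of the two representations on generators *)

Section Specs.
Variable n : nat.
Local Notation FT := (presented (FT_pres n)).
Local Notation FM := (presented (FM_pres n)).
Local Notation y := (@FT_y n).
Local Notation x := (@FM_x n).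
Local Notation u := (@FM_u n).
Local Notation v := (@FM_v n).
Local Notation v0 := (@FM_v0 n).
Local Notation w := (@FM_w n).
Local Notation z := (@FM_z n).
Local Notation emb := (emb n).
Implicit Types i : 'I_n.-1.

Lemma low_neq_high i : low i != high i.
Proof. by rewrite -val_eqE /= neq_ltn ltnSn. Qed.

Lemma intertwine_tperm (F : aut FM) (f : aut FT) i : lifts F f ->
  (forall j, f (FT_v j) = FT_v (tperm (low i) (high i) j)) ->
  intertwine F f (tperm (low i) (high i)).
Proof.
move=> [s Ff] fv; suff <- : s = tperm (low i) (high i) by [].
by apply/permP => j; apply: (@FT_v_inj n); rewrite -fv; case: Ff => _ _ _ ->.
Qed.

(** As [high i] exceeds [low i] by one, the power falls one short of undoing the twist of
    [z (high i)]. *)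
Lemma z_high_pow_low i : z (high i) ^ (v0 ^+ low i) = w (high i) ^ v0^-1.
Proof. rewrite -(z_w (high i)) [v0 ^+ high i]expgSr conjgM conjgK. done. Qed.

Lemma z_low_pow_high i : z (low i) ^ (v0 ^+ high i) = w (low i) ^ v0.
Proof. by rewrite -(z_w (low i)) [v0 ^+ high i]expgSr conjgM. Qed.

Lemma emb_conj_pow (g h : FT) (k : nat) :
  emb (g ^ h) ^ (v0 ^+ k) = (emb g ^ (v0 ^+ k)) ^ (emb h ^ (v0 ^+ k)).
Proof. by rewrite gmulfJ conjJg. Qed.

Lemma conjg_fixC (G : groupType) (a b : G) : commute a b -> a ^ b = a.
Proof. by move=> ab; rewrite /conjg ab mulKg. Qed.

Lemma emb_v_pow j k : emb (FT_v j) ^ (v0 ^+ k) = v j * v0^-1.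
Proof.
rewrite emb_v; apply/conjg_fixC/commuteX/commute_sym/commuteM.
  exact/commute_sym/FM_vv0C.
exact/commuteV.
Qed.

Lemma lifts_sigma F f i :
  lifts F f -> tphiM_sigma_spec i f -> phiM_sigma_spec i F.
Proof.
move=> Ff [[fl fh fo] fv]; have I := intertwine_tperm Ff fv.
have Fx := intertwine_x _ I; have [_ F0 Fu _] := I.
split=> // [|j]; last exact: (intertwine_v _ I).
split=> [||j jl jh].
- rewrite Fx /= fl tpermL; set e := _ ^ _.
  have -> : e = w (low i) * w (high i) ^ v0^-1 / w (low i).
    by rewrite /e !gmulfM gmulfV /= !emb_y conjg_conj z_w z_high_pow_low.
  apply: sigma_low_identity; first exact: FM_uv0C.
  exact: FM_uC.
- rewrite Fx /= fh tpermR emb_y z_low_pow_high.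
  exact/sigma_high_identity/FM_uv0C.
- by rewrite Fx /= fo // tpermD 1?eq_sym // emb_y z_w w_x.
Qed.

Lemma lifts_rho F f i : lifts F f -> tphiM_rho_spec i f -> phiM_rho_spec i F.
Proof.
move=> Ff [[fl fh fo] fv]; have I := intertwine_tperm Ff fv.
have Fx := intertwine_x _ I; have [_ F0 Fu _] := I.
split=> // [|j]; last exact: (intertwine_v _ I).
split=> [||j jl jh].
- rewrite Fx /= fl tpermL emb_conj_pow gmulfV conjVg emb_v_pow emb_y.
  (* The [v0^-1] left by the index shift cancels the [v0] in the inverse of [v (low i) * v0^-1],
     leaving the exponent [(v (low i))^-1]. *)
  rewrite z_high_pow_low -conjgM invgM invgK mulKg.
  by apply: conj_shift; apply: commuteVl; [exact: FM_vv0C|exact: FM_vuC].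
- rewrite Fx /= fh tpermR emb_conj_pow emb_v_pow emb_y z_low_pow_high.
  rewrite -conjgM mulgA -FM_vv0C mulgK.
  by apply: conj_shift; [exact: FM_vv0C|exact: FM_vuC].
- by rewrite Fx /= fo // tpermD 1?eq_sym // emb_y z_w w_x.
Qed.

Lemma phiM_sigma_unique i F G :
  phiM_sigma_spec i F -> phiM_sigma_spec i G -> F = G.
Proof.
move=> [[Fl Fh Fo] Fu F0 Fv] [[Gl Gh Go] Gu G0 Gv]; apply: autP.
apply: FM_eq => [j|j||j]; rewrite /= ?Fu ?Gu ?F0 ?G0 ?Fv ?Gv //.
case: (eqVneq j (low i)) => [->|jl]; first by rewrite Fl Gl.
by case: (eqVneq j (high i)) => [->|jh]; rewrite ?Fh ?Gh ?Fo ?Go.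
Qed.

Lemma phiM_rho_unique i F G :
  phiM_rho_spec i F -> phiM_rho_spec i G -> F = G.
Proof.
move=> [[Fl Fh Fo] Fu F0 Fv] [[Gl Gh Go] Gu G0 Gv]; apply: autP.
apply: FM_eq => [j|j||j]; rewrite /= ?Fu ?Gu ?F0 ?G0 ?Fv ?Gv //.
case: (eqVneq j (low i)) => [->|jl]; first by rewrite Fl Gl.
by case: (eqVneq j (high i)) => [->|jh]; rewrite ?Fh ?Gh ?Fo ?Go.
Qed.

Definition sigma_aut i : aut FT :=
  aut_of (sigmaK (low_neq_high i)) (sigmaKV (low_neq_high i)).
Definition rho_aut i : aut FT :=
  aut_of (rhoK (low_neq_high i)) (rhoK (low_neq_high i)).

Lemma sigma_autP i : tphiM_sigma_spec i (sigma_aut i).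
Proof.
have lh := low_neq_high i.
split=> [|j]; last by rewrite /= FT_lift_v.
split=> [||j jl jh]; rewrite /= FT_lift_y ?eqxx //.
  by rewrite eq_sym (negPf lh).
by rewrite (negPf jl) (negPf jh).
Qed.

Lemma rho_autP i : tphiM_rho_spec i (rho_aut i).
Proof.
have lh := low_neq_high i.
split=> [|j]; last by rewrite /= FT_lift_v.
split=> [||j jl jh]; rewrite /= FT_lift_y ?eqxx //.
  by rewrite eq_sym (negPf lh).
by rewrite (negPf jl) (negPf jh).
Qed.

Definition VB_aut (g : VB_gen n) : aut FT :=
  match g with Sigma i => sigma_aut i | Rho i => rho_aut i end.

Lemma far_neq (i j : 'I_n.-1) : far i j ->
  [/\ low i != low j, low i != high j, high i != low j & high i != high j].
Proof. by rewrite /far -!val_eqE /= => ij; split; lia. Qed.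

Lemma consecutive_neq (i j : 'I_n.-1) : j = i.+1 :> nat ->
  [/\ high i = low j, low i != high i, low j != high j & low i != high j].
Proof.
move=> ji; split; try exact: low_neq_high; first exact: val_inj.
by rewrite -val_eqE /= ji ltn_eqF // leqW.
Qed.

Lemma VB_aut_respects : @respects (VB_pres n) (aut FT) VB_aut.
Proof.
move=> w1 w2 [] i; rewrite /word_eval /= ?big_cons ?big_nil ?mulg1 /letter_eval /=.
- move=> j /consecutive_neq[e l1 l2 l3]; rewrite !big_cons !big_nil !mulg1 /=.
  (* Rewriting [high i] as [low j] leaves the three strands [low i], [low j], [high j]. *)
  apply: autP => g /=; rewrite e in l1 *; exact: (sigma_braid l1 l2 l3 g).
- move=> j /consecutive_neq[e l1 l2 l3]; rewrite !big_cons !big_nil !mulg1 /=.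
  apply: autP => g /=; rewrite e in l1 *; exact: (rho_braid l1 l2 l3 g).
- move=> j /consecutive_neq[e l1 l2 l3]; rewrite !big_cons !big_nil !mulg1 /=.
  apply: autP => g /=; rewrite e in l1 *; exact: (rho_sigma_braid l1 l2 l3 g).
- move=> j /far_neq[d1 d2 d3 d4]; rewrite !big_cons !big_nil !mulg1 /=.
  apply: autP => g; apply: sigma_commute => //; exact: low_neq_high.
- move=> j /far_neq[d1 d2 d3 d4]; rewrite !big_cons !big_nil !mulg1 /=.
  apply: autP => g; apply: rho_commute => //; exact: low_neq_high.
- move=> j /far_neq[d1 d2 d3 d4]; rewrite !big_cons !big_nil !mulg1 /=.
  apply: autP => g; apply: sigma_rho_commute => //; exact: low_neq_high.
by apply: autP => g; apply: rhoK; apply: low_neq_high.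
Qed.

Lemma lifts_word_eval (F : VB_gen n -> aut FM) (f : VB_gen n -> aut FT) w :
    (forall g, lifts (F g) (f g)) ->
  lifts (@word_eval (VB_pres n) _ F w) (@word_eval (VB_pres n) _ f w).
Proof.
move=> Ff; rewrite /word_eval; elim: w => [|[g e] w IH].
  by rewrite !big_nil; apply: lifts1.
rewrite !big_cons; apply: liftsM IH; rewrite /letter_eval /=.
by case: e => /=; [apply: liftsV|].
Qed.

Lemma VB_aut_lifts g : exists F, lifts F (VB_aut g).
Proof.
case: g => i; apply: (@lifts_exists _ _ (tperm (low i) (high i))) => j.
  by case: (sigma_autP i).
by case: (rho_autP i).
Qed.

Lemma lifts_of_specs (phi : {multiplicative VB n -> aut FM})
    (tphi : {multiplicative VB n -> aut FT}) b :
  is_phiM phi -> is_tphiM tphi -> lifts (phi b) (tphi b).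
Proof.
move=> Hphi Htphi; have gen c : lifts (phi (pgenerator c)) (tphi (pgenerator c)).
  case: c => i; have [Ps Pr] := Hphi i; have [Ts Tr] := Htphi i.
    have [F FT] := lifts_exists (proj2 Ts).
    (* A lift of the tilde generator obeys the same formulas as the value of [phi], and those
       formulas fix an automorphism. *)
    by rewrite (phiM_sigma_unique Ps (lifts_sigma FT Ts)).
  have [F FT] := lifts_exists (proj2 Tr).
  by rewrite (phiM_rho_unique Pr (lifts_rho FT Tr)).
elim/presented_ind: b => [|c g IH|c g IH].
- by rewrite !multiplicative1; apply: lifts1.
- by rewrite !gmulfM; apply: liftsM.
- by rewrite !gmulfM !multiplicativeV; apply: liftsM => //; apply: liftsV.
Qed.

End Specs.

Theorem theorem2 (n : nat) (hn : 2 <= n) :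
  [/\ exists phi : {multiplicative VB n -> aut (FM n)}, is_phiM phi,
      exists tphi : {multiplicative VB n -> aut (FT n)}, is_tphiM tphi
    & forall (phi : {multiplicative VB n -> aut (FM n)})
             (tphi : {multiplicative VB n -> aut (FT n)}),
        is_phiM phi -> is_tphiM tphi -> equivalent_rep tphi phi].
Proof.
split.
- have [F FV] := choice (@VB_aut_lifts n).
  have FR : @respects (VB_pres n) _ F.
    (* The chosen lifts inherit the relation: both words evaluate to lifts of one automorphism of
       F_(n,n). *)
    move=> w1 w2 w12; apply: lifts_unique (lifts_word_eval w1 FV) _.
    by rewrite (VB_aut_respects w12); apply: lifts_word_eval.
  exists (plift FR) => i; rewrite /sigma /rho /= !plift_generator.
  split; first exact: lifts_sigma (FV (Sigma i)) (sigma_autP i).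
  exact: lifts_rho (FV (Rho i)) (rho_autP i).
- exists (plift (@VB_aut_respects n)) => i.
  rewrite /sigma /rho /= !plift_generator.
  by split; [exact: sigma_autP|exact: rho_autP].
- by move=> phi tphi Hphi Htphi b; apply/lifts_eq1/lifts_of_specs.
Qed.
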